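(* Let $(G,\cdot)$ be a groupoid with left cancellation, i.e. for all $a,b,c\in G$, $a\cdot b=a\cdot c$ implies $b=c$. Suppose that $G$ satisfies the identities $$(y\cdot z)\cdot(x\cdot x) = (y\cdot x)\cdot(z\cdot x)\quad\text{for all } x,y,z\in G,$$ $$\bigl(x\cdot (x\cdot x)\bigr)\cdot(u\cdot v) = (x\cdot u)\cdot\bigl((x\cdot x)\cdot v\bigr)\quad\text{for all } x,u,v\in G.$$ Then $G$ also satisfies the identity $$(x\cdot x)\cdot(y\cdot z) = (x\cdot y)\cdot(x\cdot z)\quad\text{for all } x,y,z\in G.$$
   Context: A groupoid is a set $G$ with a binary operation $\cdot$ (no further axioms assumed). *)

(* Defs.v *)
From mathcomp Require Export all_boot.

(* Main.v *)
Require Import Defs.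
From mathcomp Require Import all_boot.

Local Open Scope group_scope.

Theorem mainTheorem2 (G : magmaType)
    (left_cancel : forall a b c : G, a * b = a * c -> b = c)
    (id1 : forall x y z : G, (y * z) * (x * x) = (y * x) * (z * x))
    (id2 : forall x u v : G,
       (x * (x * x)) * (u * v) = (x * u) * ((x * x) * v)) :
  forall x y z : G, (x * x) * (y * z) = (x * y) * (x * z).
Proof.
move=> x y z.
(* The factor [x * (x * z)] lets [id2] act on the left side and is also what the last use of [id1]
   produces. *)
apply: (left_cancel (x * (x * z))).
(* The left side becomes in turn [(x(xx))((xz)(yz))], [(x(xx))((xy)(zz))], [(x(xy))((xx)(zz))],
   [(x(xy))((xz)(xz))] and [(x(xz))((xy)(xz))]. Squaring [z] in the second form is what lets [y] and
   [z] trade places. *)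
by rewrite -id2 -id1 id2 id1 id1.
Qed.
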